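(* Let $\Bbbk$ be a field, $S=\Bbbk[x_1,\ldots,x_n]$, and let $I\subseteq S$ be a monomial ideal with minimal monomial generators $m_1,\ldots,m_q$. The following are equivalent: (1) the LCM lattice $\mathcal{L}_I$ is a Boolean lattice; (2) for each $i$ there is a variable $x_{j_i}$ and a positive integer $n_i$ such that $x_{j_i}^{n_i}\mid m_i$ and $x_{j_i}^{n_i}\nmid m_j$ for $j\neq i$; (3) the Taylor resolution $\mathbf{T}_\bullet$ of $S/I$ is minimal; (4) $\operatorname{pd}_S(S/I)=\mu(I)$.
   Context: The LCM lattice $\mathcal{L}_I$ of a monomial ideal $I$ with minimal monomial generators $m_1,\ldots,m_q$ is the set of least common multiples of subsets of $\{m_1,\ldots,m_q\}$ (the lcm of the empty set is $1$), ordered by divisibility; it is a finite lattice with join given by lcm and bottom element $1$. A bounded lattice is Boolean if it is distributive and every element has exactly one complement (a complement of $x$ is a $y$ with $x\wedge y=\hat 0$, $x\vee y=\hat 1$). $\mu(I)=q$ is the minimal number of generators of $I$ and $\operatorname{pd}_S$ is projective dimension. The Taylor resolution: let $\Lambda$ be the exterior algebra over $\Bbbk^q$ with standard basis $e_1,\ldots,e_q$, and $\Lambda_i$ the span of the elements $e_{j_1}\wedge\cdots\wedge e_{j_i}$. Set $\mathbf{T}_i=S\otimes_\Bbbk\Lambda_i$ for $0\le i\le q$, with differential $$d(e_{j_1}\wedge\cdots\wedge e_{j_i})=\sum_{1\le p\le i}(-1)^{p-1}\frac{\operatorname{lcm}(m_{j_1},\ldots,m_{j_i})}{\operatorname{lcm}(m_{j_1},\ldots,\widehat{m_{j_p}},\ldots,m_{j_i})}\otimes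 e_{j_1}\wedge\cdots\wedge\widehat{e_{j_p}}\wedge\cdots\wedge e_{j_i},$$ where hats denote omission. It is a free resolution of $S/I$. It is minimal if $d(\mathbf{T}_i)\subseteq(x_1,\ldots,x_n)\mathbf{T}_{i-1}$ for all $i$.
   Formalization: The ideal I is assumed proper: for I = S the only minimal generator is 1, so the LCM lattice {1} is Boolean under the stated definition while (2) and (3) fail, and the equivalence is false there. *)

(* Defs.v *)
From HB Require Import structures.
From mathcomp Require Import all_boot all_order all_algebra.
From mathcomp Require Import mpoly.

Set Implicit Arguments.
Unset Strict Implicit.
Unset Printing Implicit Defensive.

Import Order.TTheory GRing.Theory.

Local Open Scope ring_scope.

(** * Boolean lattices *)

Section BooleanLattice.
Local Open Scope order_scope.

Definition complements d (L : tbLatticeType d) (x y : L) : Prop :=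
  x `&` y = \bot /\ x `|` y = \top.

Definition boolean_lattice d (L : tbLatticeType d) : Prop :=
  (forall x y z : L, x `&` (y `|` z) = (x `&` y) `|` (x `&` z)) /\
  (forall x : L, exists! y : L, complements x y).

End BooleanLattice.

(** * The LCM lattice of a family of monomials *)

Fact lcm_display : Order.disp_t.
Proof. exact: Order.Disp tt tt. Qed.

Section LcmLattice.
Variables (n q : nat) (m : 'I_q -> 'X_{1..n}).
Implicit Types (A B : {set 'I_q}) (u v : 'X_{1..n}).

Definition lcm_of A : 'X_{1..n} := \big[@mlcm n/0%MM]_(i in A) m i.

Definition lcms : {pred 'X_{1..n}} := [pred u | [exists A, u == lcm_of A]].

Record lcm_lattice := LcmLattice {
  lcm_val :> 'X_{1..n};
  lcm_valP : lcm_val \in lcms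
}.

HB.instance Definition _ := [isSub for lcm_val].
HB.instance Definition _ := [Choice of lcm_lattice by <:].

Lemma lem_lcm_of A u : (lcm_of A <= u)%MM = [forall (i | i \in A), (m i <= u)%MM].
Proof.
rewrite -big_andE /lcm_of; elim/big_rec2: _ => [|i b v _ <-].
  by apply/mnm_lepP => j; rewrite mnm0E.
by rewrite lem_mlcm.
Qed.

Lemma lem_lcm_ofP A u :
  reflect (forall i, i \in A -> (m i <= u)%MM) (lcm_of A <= u)%MM.
Proof. by rewrite lem_lcm_of; exact: forall_inP. Qed.

Lemma lem_anti u v : (u <= v)%MM -> (v <= u)%MM -> u = v.
Proof.
move=> /mnm_lepP uv /mnm_lepP vu; apply/mnmP => j.
by apply/eqP; rewrite eqn_leq uv vu.
Qed.

Lemma lcm_of_ub A i : i \in A -> (m i <= lcm_of A)%MM.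
Proof. by move: i; apply/lem_lcm_ofP/lepm_refl. Qed.

Lemma lcm_ofU A B : lcm_of (A :|: B) = mlcm (lcm_of A) (lcm_of B).
Proof.
apply: lem_anti; last first.
  by rewrite lem_mlcm; apply/andP; split; apply/lem_lcm_ofP => i iX;
     apply: lcm_of_ub; rewrite inE iX ?orbT.
apply/lem_lcm_ofP => i /setUP[] /lcm_of_ub iX; apply: lepm_trans iX _.
  exact: lem_mlcml.
exact: lem_mlcmr.
Qed.

Lemma lcm_of_lcms A : lcm_of A \in lcms.
Proof. by apply/existsP; exists A. Qed.

Definition lcm_elt A : lcm_lattice := LcmLattice (lcm_of_lcms A).

Lemma lcm_eltP (x : lcm_lattice) : exists A, x = lcm_elt A.
Proof.
by have /existsP[A /eqP xA] := lcm_valP x; exists A; apply: val_inj.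
Qed.

Lemma mlcm_lcms (x y : lcm_lattice) : mlcm x y \in lcms.
Proof.
have [[A ->] [B ->]] := (lcm_eltP x, lcm_eltP y).
by rewrite /= -lcm_ofU lcm_of_lcms.
Qed.

Definition lcm_join (x y : lcm_lattice) : lcm_lattice :=
  LcmLattice (mlcm_lcms x y).

(* The meet is in general not the gcd of monomials, which need not lie in the
   lattice. *)
Definition lcm_meet (x y : lcm_lattice) : lcm_lattice :=
  lcm_elt [set i | (m i <= x)%MM && (m i <= y)%MM].

Definition lcm_le (x y : lcm_lattice) : bool := (lcm_val x <= lcm_val y)%MM.

Lemma lcm_le_refl : reflexive lcm_le.
Proof. by move=> x; exact: lepm_refl. Qed.

Lemma lcm_le_anti : antisymmetric lcm_le.
Proof. by move=> x y /andP[xy yx]; apply/val_inj/lem_anti. Qed.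

Lemma lcm_le_trans : transitive lcm_le.
Proof. by move=> y x z; exact: lepm_trans. Qed.

HB.instance Definition _ := Order.Le_isPOrder.Build lcm_display
  lcm_lattice lcm_le_refl lcm_le_anti lcm_le_trans.

Lemma lcm_meetP (x y z : lcm_lattice) :
  (x <= lcm_meet y z)%O = (x <= y)%O && (x <= z)%O.
Proof.
rewrite -![(_ <= _)%O]/(_ <= _)%MM; apply/idP/andP => [xm|[]].
  by split; apply: lepm_trans xm _; apply/lem_lcm_ofP => i; rewrite inE => /andP[].
have [A -> /lem_lcm_ofP xy /lem_lcm_ofP xz] := lcm_eltP x.
by apply/lem_lcm_ofP => i iA; apply: lcm_of_ub; rewrite inE xy ?xz.
Qed.

Lemma lcm_joinP (x y z : lcm_lattice) :
  (lcm_join x y <= z)%O = (x <= z)%O && (y <= z)%O.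
Proof. exact: lem_mlcm. Qed.

HB.instance Definition _ := Order.POrder_MeetJoin_isLattice.Build
  lcm_display lcm_lattice lcm_meetP lcm_joinP.

Lemma lcm_le0x (x : lcm_lattice) : (lcm_elt set0 <= x)%O.
Proof. by apply/lem_lcm_ofP => i; rewrite inE. Qed.

Lemma lcm_lex1 (x : lcm_lattice) : (x <= lcm_elt setT)%O.
Proof.
have [A ->] := lcm_eltP x; apply/lem_lcm_ofP => i _.
by apply: lcm_of_ub; rewrite inE.
Qed.

HB.instance Definition _ :=
  Order.hasBottom.Build lcm_display lcm_lattice lcm_le0x.
HB.instance Definition _ :=
  Order.hasTop.Build lcm_display lcm_lattice lcm_lex1.

End LcmLattice.

(** * Generators of ideals *)

Section Generators.
Variables (R : comNzRingType) (I : {pred R}).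

Definition generated_by d (f : 'I_d -> R) (A : {set 'I_d}) : Prop :=
  forall g : R,
    g \in I <-> exists c : 'I_d -> R, g = \sum_(i in A) c i * f i.

Definition min_number_of_generators d : Prop :=
  (exists f : 'I_d -> R, generated_by f setT) /\
  (forall e (f : 'I_e -> R), generated_by f setT -> (d <= e)%N).

End Generators.

(* Irredundancy makes the monomials [m i] pairwise distinct. *)
Definition minimal_monomial_generators (k : fieldType) n
    (I : {pred {mpoly k[n]}}) q (m : 'I_q -> 'X_{1..n}) : Prop :=
  let f (i : 'I_q) : {mpoly k[n]} := 'X_[m i] in
  generated_by I f setT /\
  (forall A : {set 'I_q}, A \proper setT -> ~ generated_by I f A).

(** * Projective dimension *)

Section ProjectiveDimension.
Variable R : nzRingType.

Definition projective (P : lmodType R) : Prop :=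
  forall (M N : lmodType R) (g : {linear M -> N}) (f : {linear P -> N}),
    (forall y, exists x, g x = y) ->
    exists h : {linear P -> M}, forall x, g (h x) = f x.

Record projective_resolution (M : lmodType R) := ProjectiveResolution {
  res_mod : nat -> lmodType R;
  res_diff : forall i, {linear res_mod i.+1 -> res_mod i};
  res_aug : {linear res_mod 0%N -> M};
  res_projective : forall i, projective (res_mod i);
  res_aug_surj : forall y, exists x, res_aug x = y;
  res_exact0 : forall x, res_aug x = 0 <-> exists y, x = res_diff 0%N y;
  res_exactS : forall i (x : res_mod i.+1),
    res_diff i x = 0 <-> exists y, x = res_diff i.+1 y
}.

Definition has_projective_resolution_of_length (M : lmodType R) d : Prop :=
  exists P : projective_resolution M,
    forall i, (d < i)%N -> forall x : res_mod P i, x = 0.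

(* [projective_dimension M d] reads [pd M = d] with [d] finite: it holds for no
   [d] when the projective dimension of [M] is infinite. *)
Definition projective_dimension (M : lmodType R) d : Prop :=
  has_projective_resolution_of_length M d /\
  (forall e, has_projective_resolution_of_length M e -> (d <= e)%N).

End ProjectiveDimension.

(** * The quotient [R / I] as an [R]-module *)

(* [idealr R] is the type of proper ideals: [1] is not a member. *)
Section QuotientModule.
Variables (R : comNzRingType) (I : idealr R).
Local Open Scope quotient_scope.

Definition quot_mod : Type := {ideal_quot I}.

HB.instance Definition _ := GRing.Zmodule.on quot_mod.

Definition quot_scale (a : R) (x : quot_mod) : quot_mod :=
  (\pi_{ideal_quot I} a : {ideal_quot I}) * (x : {ideal_quot I}).

Lemma quot_scaleA a b x : quot_scale a (quot_scale b x) = quot_scale (a * b) x.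
Proof. by rewrite /quot_scale rmorphM mulrA. Qed.

Lemma quot_scale1 : left_id 1 quot_scale.
Proof. by move=> x; rewrite /quot_scale rmorph1 mul1r. Qed.

Lemma quot_scaleDr : right_distributive quot_scale +%R.
Proof. by move=> a x y; exact: mulrDr. Qed.

Lemma quot_scaleDl x : {morph quot_scale^~ x : a b / a + b}.
Proof. by move=> a b; rewrite /quot_scale rmorphD; exact: mulrDl. Qed.

HB.instance Definition _ := GRing.Zmodule_isLmodule.Build R quot_mod
  quot_scaleA quot_scale1 quot_scaleDr quot_scaleDl.

End QuotientModule.

(** * The Taylor complex *)

Section Taylor.
Variables (k : fieldType) (n q : nat) (m : 'I_q -> 'X_{1..n}).
Local Notation S := {mpoly k[n]}.

(* The wedges e_{j_1} /\ ... /\ e_{j_i} with j_1 < ... < j_i form a basis of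
   Lambda_i; such a wedge is encoded by the i-element set {j_1, ..., j_i}.
   Thus T_i = S (x) Lambda_i is the free S-module on the i-subsets of 'I_q. *)
Definition wedge_index i : Type := {A : {set 'I_q} | #|A| == i}.

HB.instance Definition _ i := Finite.on (wedge_index i).

Definition taylor_mod i : lmodType S := {ffun wedge_index i -> S^o}.

(* Meaningful when #|A| = i (and 0 otherwise). *)
Definition wedge i (A : {set 'I_q}) : taylor_mod i :=
  [ffun B => (val B == A)%:R].

(* If a = j_p in A = {j_1 < ... < j_i}, then p - 1 is the number of elements
   of A below a. The truncated subtraction of exponents is an exact division,
   as lcm (A \ a) divides lcm A. *)
Definition taylor_diff_wedge i (A : {set 'I_q}) : taylor_mod i :=
  \sum_(a in A)
    ((-1) ^+ #|[set b in A | (b < a)%N]| * 'X_[lcm_of m A - lcm_of m (A :\ a)])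
      *: wedge i (A :\ a).

Definition taylor_diff i (t : taylor_mod i.+1) : taylor_mod i :=
  \sum_A t A *: taylor_diff_wedge i (val A).

Lemma taylor_diff_is_linear i : linear (@taylor_diff i).
Proof.
move=> a s t; rewrite /taylor_diff scaler_sumr -big_split /=.
by apply: eq_bigr => A _; rewrite !ffunE scalerDl scalerA.
Qed.

HB.instance Definition _ i := GRing.isLinear.Build S (taylor_mod i.+1)
  (taylor_mod i) *:%R (@taylor_diff i) (@taylor_diff_is_linear i).

(* Membership in (x_1, ..., x_n) M. *)
Definition in_max_ideal_mul (M : lmodType S) (y : M) : Prop :=
  exists t : 'I_n -> M, y = \sum_(j < n) 'X_j *: t j.

Definition taylor_minimal : Prop :=
  forall i (t : taylor_mod i.+1), in_max_ideal_mul (taylor_diff t).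

End Taylor.

Arguments taylor_minimal k [n q] m.

(* Main.v *)
(* Multiplying the coordinate of a Taylor chain at the subset A
   by the monomial lcm(A) turns the Taylor differential into the boundary
   operator of a simplex; coning off, monomial by monomial, the first generator
   dividing the monomial contracts that boundary, so the Taylor complex is a
   resolution of length q. A resolution of length less than q would split the
   last Taylor differential, which is impossible when that differential has
   entries in (x_1, ..., x_n). Conversely, if m_i divides the lcm of the other
   generators, the last differential has an entry +-1 and can be cancelled,
   leaving a resolution of length q - 1.

   Condition (2) says that no m_i divides the lcm of the
   others. Then A |-> lcm(A) identifies the lcm lattice with the Boolean lattice
   of all subsets; if instead m_i divides that lcm, distributivity gives
   m_i = m_i /\ \/_{l <> i} m_l = \/_{l <> i} (m_i /\ m_l) = 1. *)
From HB Require Import structures.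
Require Import Defs.
From mathcomp Require Import all_boot all_order all_algebra.
From mathcomp Require Import mpoly ring.

Set Implicit Arguments.
Unset Strict Implicit.
Unset Printing Implicit Defensive.

Import Order.TTheory GRing.Theory.

Local Open Scope ring_scope.

(** * Kernels and projective modules *)

Section Kernel.
Variables (R : nzRingType) (U V : lmodType R) (f : {linear U -> V}).

Definition ker_pred : {pred U} := [pred x | f x == 0].

Fact ker_submod_closed : submod_closed ker_pred.
Proof.
split=> [|a x y]; first by rewrite inE linear0.
by rewrite !inE linearP => /eqP-> /eqP->; rewrite scaler0 addr0.
Qed.

HB.instance Definition _ :=
  GRing.isSubmodClosed.Build R U ker_pred ker_submod_closed.

Record kernel := Kernel { ker_val :> U; ker_valP : ker_val \in ker_pred }.

HB.instance Definition _ := [isSub for ker_val].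
HB.instance Definition _ := [Choice of kernel by <:].
HB.instance Definition _ := [SubChoice_isSubLmodule of kernel by <:].

Lemma kerP (x : kernel) : f (ker_val x) = 0.
Proof. by apply/eqP; have := ker_valP x; rewrite inE. Qed.

End Kernel.

Section LinearIntoKernel.
Variables (R : nzRingType) (U V W : lmodType R) (f : {linear U -> V}).
Variables (g : {linear W -> U}) (fg : forall x, f (g x) = 0).

Fact into_kernel_subproof x : g x \in ker_pred f.
Proof. by rewrite inE fg. Qed.

Definition into_kernel (x : W) : kernel f := Kernel (into_kernel_subproof x).

Fact into_kernel_is_linear : linear into_kernel.
Proof. by move=> a x y; apply: val_inj; rewrite /= linearP. Qed.

HB.instance Definition _ :=
  GRing.isLinear.Build R W (kernel f) *:%R into_kernel into_kernel_is_linear.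

End LinearIntoKernel.

Section Projective.
Variable R : nzRingType.
Implicit Types F A B C : lmodType R.

(** Exactness at [B] makes [d1] surjective onto the kernel of [d0], where [phi] takes its values;
    projectivity of [F] is applied to that surjection. *)
Lemma projective_lift F A B C (d1 : {linear A -> B}) (d0 : {linear B -> C})
    (phi : {linear F -> B}) :
  projective F -> (forall y, d0 y = 0 -> exists x, y = d1 x) ->
  (forall x, d0 (d1 x) = 0) -> (forall x, d0 (phi x) = 0) ->
  exists psi : {linear F -> A}, forall x, d1 (psi x) = phi x.
Proof.
move=> projF exact_B d0d1 d0phi.
pose g : {linear A -> kernel d0} := into_kernel d0d1.
pose f : {linear F -> kernel d0} := into_kernel d0phi.
have [y|h gh] := projF _ _ g f.
  by have [x yx] := exact_B _ (kerP y); exists x; apply: val_inj; rewrite /= yx.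
by exists h => x; have /(congr1 val) := gh x.
Qed.

Lemma projective_retract F A (i : {linear A -> F}) (p : {linear F -> A}) :
  (forall x, p (i x) = x) -> projective F -> projective A.
Proof.
move=> pK projF M N g f g_surj.
have [h gh] := projF M N g (f \o p) g_surj.
by exists (h \o i) => x; rewrite /= gh /= pK.
Qed.

Lemma projective_free (J : finType) : projective {ffun J -> R^o}.
Proof.
move=> M N g f g_surj.
pose delta j : {ffun J -> R^o} := [ffun j' => (j' == j)%:R].
have [c gc] : exists c : J -> M, forall j, g (c j) = f (delta j).
  have /fin_all_exists : forall j, exists x, g x = f (delta j) by move=> j.
  by [].
pose h (t : {ffun J -> R^o}) : M := \sum_j t j *: c j.
have h_lin : linear h.
  move=> a s t; rewrite /h scaler_sumr -big_split /=.
  by apply: eq_bigr => j _; rewrite !ffunE scalerDl scalerA.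
pose H := GRing.isLinear.Build R _ M *:%R h h_lin.
pose hl : {linear _ -> _} := HB.pack h H.
exists hl => t; rewrite /= /h linear_sum /=.
have {2}-> : t = \sum_j t j *: delta j.
  apply/ffunP=> j; rewrite sum_ffunE (bigD1 j) //= !ffunE eqxx /=.
  rewrite big1 => [|j' /negPf j'j]; last first.
    by rewrite !ffunE eq_sym j'j scaler0.
  by rewrite addr0 [_ *: _]mulr1.
by rewrite linear_sum; apply: eq_bigr => j _; rewrite !linearZ gc.
Qed.

End Projective.

(** * Comparing and shortening projective resolutions *)

Section Comparison.
Variable R : nzRingType.

(** One degree of the comparison. In use [w] is zero or the earlier homotopy after a differential;
    as [d0] kills [x - g (f x) - w x], this element lifts through [d1] to [h x]. *)
Lemma homotopy_step (P' P C Q' Q C' : lmodType R)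
    (d1 : {linear P' -> P}) (d0 : {linear P -> C})
    (e1 : {linear Q' -> Q}) (e0 : {linear Q -> C'})
    (f : {linear P -> Q}) (g : {linear Q -> P}) (w : {linear P -> P}) :
  projective P' -> projective Q' -> projective P ->
  (forall y, d0 y = 0 <-> exists x, y = d1 x) ->
  (forall y, e0 y = 0 <-> exists x, y = e1 x) ->
  (forall x, w (d1 x) = 0) -> (forall x, d0 (x - g (f x) - w x) = 0) ->
  (forall x, e0 (f (d1 x)) = 0) -> (forall y, d0 (g (e1 y)) = 0) ->
  exists (f' : {linear P' -> Q'}) (g' : {linear Q' -> P'})
         (h : {linear P -> P'}),
    [/\ forall x, d1 (x - g' (f' x) - h (d1 x)) = 0,
        forall x, e1 (f' x) = f (d1 x) & forall y, d1 (g' y) = g (e1 y)].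
Proof.
move=> projP' projQ' projP exP exQ wd du ef dg.
have dd x : d0 (d1 x) = 0 by apply/exP; exists x.
have ee x : e0 (e1 x) = 0 by apply/exQ; exists x.
have [f' f'E] := projective_lift (phi := f \o d1) projP'
  (fun y => (exQ y).1) ee ef.
have [g' g'E] := projective_lift (phi := g \o e1) projQ'
  (fun y => (exP y).1) dd dg.
have [h hE] := projective_lift (phi := ((idfun \- (g \o f)) \- w)) projP
  (fun y => (exP y).1) dd du.
exists f', g', h; split=> // x.
by rewrite !linearB hE g'E /= f'E /= wd subr0 subrr.
Qed.

(** The homotopy identity is kept only after applying the differential: this is the form that the
    next degree takes as input. *)
Lemma resolution_homotopy (M : lmodType R) (P Q : projective_resolution M) i :
  exists (f : {linear res_mod P i.+1 -> res_mod Q i.+1})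
         (g : {linear res_mod Q i.+1 -> res_mod P i.+1})
         (h : {linear res_mod P i -> res_mod P i.+1}),
    [/\ forall x, res_diff P i (x - g (f x) - h (res_diff P i x)) = 0,
        forall x, res_diff Q i (f (res_diff P i.+1 x)) = 0
      & forall y, res_diff P i (g (res_diff Q i.+1 y)) = 0].
Proof.
have dd (P' : projective_resolution M) j x :
    res_diff P' j (res_diff P' j.+1 x) = 0.
  by apply/(@res_exactS _ _ P'); exists x.
have ad (P' : projective_resolution M) x : res_aug P' (res_diff P' 0 x) = 0.
  by apply/(@res_exact0 _ _ P'); exists x.
elim: i => [|i [f [g [h [dh df dg]]]]].
  have [f fE] := res_projective (res_aug P) (@res_aug_surj _ _ Q).
  have [g gE] := res_projective (res_aug Q) (@res_aug_surj _ _ P).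
  have [||||f' [g' [h [hE f'E g'E]]]] := @homotopy_step _ _ _ _ _ _
    (res_diff P 0) (res_aug P) (res_diff Q 0) (res_aug Q) f g \0
    (res_projective (i := _)) (res_projective (i := _))
    (res_projective (i := _)) (@res_exact0 _ _ P) (@res_exact0 _ _ Q).
  - by [].
  - by move=> x; rewrite /= subr0 linearB gE fE subrr.
  - by move=> x; rewrite fE ad.
  - by move=> y; rewrite gE ad.
  exists f', g', h; split=> // x; first by rewrite f'E dd linear0.
  by rewrite g'E dd linear0.
have [||||f' [g' [h' [hE f'E g'E]]]] := @homotopy_step _ _ _ _ _ _
  (res_diff P i.+1) (res_diff P i) (res_diff Q i.+1) (res_diff Q i) f g
  (h \o res_diff P i) (res_projective (i := _)) (res_projective (i := _))
  (res_projective (i := _)) (@res_exactS _ _ P i) (@res_exactS _ _ Q i).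
- by move=> x; rewrite /= dd linear0.
- by [].
- by [].
- by [].
exists f', g', h'; split=> // x; first by rewrite f'E dd linear0.
by rewrite g'E dd linear0.
Qed.

(* A shorter resolution Q makes the maps P -> Q -> P vanish in degree i.+1, so
   that the homotopy splits the top differential of P. *)
Lemma top_differential_split (M : lmodType R) (P : projective_resolution M) i e :
  has_projective_resolution_of_length M e -> (e <= i)%N ->
  (forall x : res_mod P i.+2, x = 0) ->
  exists h : {linear res_mod P i -> res_mod P i.+1},
    forall x, h (res_diff P i x) = x.
Proof.
move=> [Q Q0] le_ei P0; have [f [g [h [hE _ _]]]] := resolution_homotopy P Q i.
exists h => x; have := hE x; rewrite (Q0 i.+1 _ (f x)) // linear0 subr0.
move=> /(@res_exactS _ _ P)[y]; rewrite (P0 y) linear0 => /eqP.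
by rewrite subr_eq0 => /eqP.
Qed.

End Comparison.

Section Shortening.
Variables (R : nzRingType) (M : lmodType R) (P : projective_resolution M).
Variable r : forall i, {linear res_mod P i -> res_mod P i.+1}.
Hypothesis rr : forall i x, r i.+1 (r i x) = 0.
Hypothesis rdr : forall i x, r i (res_diff P i (r i x)) = r i x.

Local Notation d := (res_diff P).

Let dd j x : d j (d j.+1 x) = 0.
Proof. by apply/(@res_exactS _ _ P); exists x. Qed.

(* d r + r d is idempotent since r^2 = 0 and r d r = r; its kernel is again a
   resolution, homotopy equivalent to P. *)
Definition contraction i : {linear res_mod P i -> res_mod P i} :=
  match i with
  | 0 => d 0 \o r 0
  | j.+1 => (d j.+1 \o r j.+1) \+ (r j \o d j)
  end.

Lemma contraction_id i x : contraction i (contraction i x) = contraction i x.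
Proof.
case: i x => [|i] x /=; first by rewrite rdr.
by rewrite !linearD /= rdr !rr !linear0 addr0 dd !linear0 add0r rdr.
Qed.

Lemma contraction_diff i x : d i (contraction i.+1 x) = contraction i (d i x).
Proof.
by case: i x => [|i] x; rewrite /= linearD /= dd add0r // dd !linear0 addr0.
Qed.

Definition short_mod i : lmodType R := kernel (contraction i).

Definition short_incl i : {linear short_mod i -> res_mod P i} :=
  \val.

Fact short_diff_subproof i (x : short_mod i.+1) :
  contraction i ((d i \o short_incl i.+1) x) = 0.
Proof. by rewrite /= -contraction_diff kerP linear0. Qed.

Definition short_diff i : {linear short_mod i.+1 -> short_mod i} :=
  into_kernel (short_diff_subproof (i := i)).

Fact short_proj_subproof i (x : res_mod P i) :
  contraction i ((idfun \- contraction i) x) = 0.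
Proof. by rewrite /= linearB /= contraction_id subrr. Qed.

(** The complementary idempotent. It commutes with the differentials, so it makes each kernel a
    direct summand and carries exactness over from [P]. *)
Definition short_proj i : {linear res_mod P i -> short_mod i} :=
  into_kernel (short_proj_subproof (i := i)).

Lemma short_inclK i x : short_proj i (short_incl i x) = x.
Proof. by apply: val_inj; rewrite /= [contraction i _]kerP subr0. Qed.

Lemma short_diff_proj i x :
  short_diff i (short_proj i.+1 x) = short_proj i (d i x).
Proof.
by apply: val_inj; rewrite [LHS]/= linearB contraction_diff.
Qed.

Lemma short_projective i : projective (short_mod i).
Proof.
apply: projective_retract (short_inclK (i := i)) _; exact: res_projective.
Qed.

Let short_aug : {linear short_mod 0 -> M} := res_aug P \o short_incl 0.

Let ad x : res_aug P (d 0 x) = 0.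
Proof. by apply/(@res_exact0 _ _ P); exists x. Qed.

(** [contraction 0] takes values in the image of [d 0], which the augmentation kills, so projecting
    a preimage keeps its augmentation. *)
Lemma short_aug_surj y : exists x, short_aug x = y.
Proof.
have [x <-] := res_aug_surj P y; exists (short_proj 0 x).
by rewrite /short_aug [LHS]/= linearB /= ad subr0.
Qed.

Lemma short_exact0 x : short_aug x = 0 <-> exists y, x = short_diff 0 y.
Proof.
split=> [/(@res_exact0 _ _ P)[y xy]|[y ->]]; last exact: ad.
by exists (short_proj 1 y); rewrite short_diff_proj -xy short_inclK.
Qed.

Lemma short_exactS i x :
  short_diff i x = 0 <-> exists y, x = short_diff i.+1 y.
Proof.
split=> [/(congr1 (short_incl i))|[y ->]]; last first.
  by apply: val_inj; rewrite /= dd.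
rewrite linear0 => /(@res_exactS _ _ P)[y xy].
by exists (short_proj i.+2 y); rewrite short_diff_proj -xy short_inclK.
Qed.

(** Above degree [e] the hypothesis says that [contraction] is the identity, so its kernel is zero
    there. *)
Lemma resolution_shorten e :
  (forall i, (e <= i)%N -> forall x, d i.+1 (r i.+1 x) + r i (d i x) = x) ->
  has_projective_resolution_of_length M e.
Proof.
move=> contr; exists (ProjectiveResolution short_projective short_aug_surj
  short_exact0 short_exactS) => -[//|i] le_ei x.
by rewrite -(short_inclK x); apply: val_inj; rewrite /= contr // subrr.
Qed.

End Shortening.

(** * The boundary operator on cochains of a simplex *)

Section Simplex.
Variables (S : comNzRingType) (q : nat).
Implicit Types (a b : 'I_q) (A B : {set 'I_q}) (phi : {set 'I_q} -> S).

Definition face_sign a A : S := (-1) ^+ #|[set b in A | (b < a)%N]|.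

(** The coefficient at the face [B] of the simplicial boundary of the chain with coefficients
    [phi]. *)
Definition boundary phi B : S :=
  \sum_(a | a \notin B) face_sign a B * phi (a |: B).

Lemma face_signU1 a b B : b \notin B ->
  face_sign a (b |: B) = (-1) ^+ (b < a)%N * face_sign a B.
Proof.
move=> bB; rewrite /face_sign -exprD; congr (_ ^+ _).
case: (boolP (b < a)%N) => ba.
  rewrite -(_ : b |: [set c in B | (c < a)%N] = [set c in b |: B | (c < a)%N]).
    by rewrite cardsU1 inE (negPf bB).
  apply/setP=> c; rewrite !inE; case: eqP => [->|//].
  by rewrite ba.
rewrite add0n; apply: eq_card => c; rewrite !inE.
by case: eqP => [->|//]; rewrite (negPf ba) !andbF.
Qed.

Lemma face_signU1s a B : face_sign a (a |: B) = face_sign a B.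
Proof.
rewrite /face_sign; congr (_ ^+ _); apply: eq_card => c; rewrite !inE.
by case: eqP => [->|//]; rewrite ltnn !andbF.
Qed.

Lemma face_signD1s a B : face_sign a (B :\ a) = face_sign a B.
Proof.
rewrite /face_sign; congr (_ ^+ _); apply: eq_card => c; rewrite !inE.
by case: eqP => [->|//]; rewrite ltnn !andbF.
Qed.

Lemma face_sign_sq a B : face_sign a B * face_sign a B = 1.
Proof. by rewrite /face_sign -expr2 sqrr_sign. Qed.

Lemma sign_ltn_swap a b : a != b ->
  (-1) ^+ (a < b)%N * (-1) ^+ (b < a)%N = -1 :> S.
Proof.
rewrite neq_ltn => /orP[] ab; rewrite ab ltnNge (ltnW ab) /=.
  by rewrite expr1 expr0 mulr1.
by rewrite expr1 expr0 mul1r.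
Qed.

Lemma face_sign_anti a b B : a != b -> a \notin B -> b \notin B ->
  face_sign a B * face_sign b (a |: B) = - (face_sign b B * face_sign a (b |: B)).
Proof.
move=> ab aB bB; rewrite !face_signU1 //.
have := sign_ltn_swap ab; rewrite neq_ltn in ab; case/orP: ab => ab;
  rewrite ab ltnNge (ltnW ab) /= => _; rewrite expr1 expr0; ring.
Qed.

Lemma face_sign_swap a b B : a != b -> a \notin B -> b \notin B ->
  face_sign b (a |: B) * face_sign a (b |: B)
  = - (face_sign a B * face_sign b B).
Proof.
move=> ab aB bB; rewrite !face_signU1 // mulrACA sign_ltn_swap //.
by rewrite mulN1r [in RHS]mulrC.
Qed.

(** Removing two vertices in either order gives opposite signs, so the terms for the pairs [(a, b)]
    and [(b, a)] cancel. *)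
Lemma boundaryK phi B : boundary (boundary phi) B = 0.
Proof.
pose G a b := face_sign a B * (face_sign b (a |: B) * phi (b |: (a |: B))).
pose P a b := (a \notin B) && (b \notin B).
have GN a b : P a b && (a < b)%N -> G a b + G b a = 0.
  case/andP=> /andP[aB bB] ab; have nab : a != b by rewrite neq_ltn ab.
  rewrite /G [in b |: (a |: B)]setUCA !mulrA face_sign_anti //.
  by rewrite mulNr addNr.
have -> : boundary (boundary phi) B =
    \sum_a \sum_(b | P a b && (a < b)%N) G a b +
    \sum_a \sum_(b | P a b && (b < a)%N) G a b.
  rewrite -big_split /boundary big_mkcond /=; apply: eq_bigr => a _.
  rewrite /P; case: (boolP (a \notin B)) => aB /=; last first.
    by rewrite !big_pred0 ?addr0 // => b; rewrite (negPf aB).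
  rewrite mulr_sumr (bigID (fun b => a < b)%N) /=; congr (_ + _).
    apply: eq_bigl => b; rewrite !inE negb_or; case: eqP => // ->.
    by rewrite ltnn !andbF.
  apply: eq_bigl => b; rewrite !inE negb_or -leqNgt ltn_neqAle -val_eqE /=.
  by case: eqP; rewrite ?andbF.
rewrite (exchange_big_dep predT) //= [X in _ + X](eq_bigr (fun a =>
  \sum_(b | P b a && (b < a)%N) G a b)); last first.
  by move=> a _; apply: eq_bigl => b; rewrite /P [(a \notin B) && _]andbC.
rewrite -big_split big1 //= => b _; rewrite -big_split big1 //= => a.
exact: GN.
Qed.

Variable p : 'I_q -> {additive S -> S}.

(** Coning with apex [a], applied to the component selected by [p a], and summed over all apexes. *)
Definition cone_homotopy phi A : S :=
  \sum_(a in A) face_sign a A * p a (phi (A :\ a)).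

Lemma boundary_homotopy phi B :
  boundary (cone_homotopy phi) B + cone_homotopy (boundary phi) B
  = \sum_a p a (phi B).
Proof.
(* The mixed terms: the boundary adds a vertex [b] outside [B], and the cone deletes a vertex [a] of
   [B]. They occur in the two composites with opposite signs; the terms with [a = b] give
   [p a (phi B)]. *)
pose G a b := face_sign b B * (face_sign a (b |: B) * p a (phi (b |: (B :\ a)))).
have p_sign a b A x : p a (face_sign b A * x) = face_sign b A * p a x.
  exact: raddfMsign.
have neq a b : a \in B -> b \notin B -> a != b.
  by move=> aB; apply: contra => /eqP<-.
have -> : boundary (cone_homotopy phi) B = \sum_(b | b \notin B) p b (phi B)
    + \sum_(b | b \notin B) \sum_(a in B) G a b.
  rewrite -big_split /=; apply: eq_bigr => b bB.
  rewrite /cone_homotopy big_setU1 //= mulrDr setU1K //; congr (_ + _).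
    by rewrite face_signU1s mulrA face_sign_sq mul1r.
  rewrite mulr_sumr; apply: eq_bigr => a aB; congr (_ * (_ * p _ (phi _))).
  apply/setP=> c; rewrite !inE; case: eqP => //= ->.
  by rewrite (negPf (neq _ _ aB bB)).
have -> : cone_homotopy (boundary phi) B = \sum_(a in B) p a (phi B)
    + \sum_(a in B) \sum_(b | b \notin B) - G a b.
  rewrite -big_split /=; apply: eq_bigr => a aB.
  rewrite /boundary raddf_sum mulr_sumr (bigD1 a) /=; last by rewrite !inE eqxx.
  rewrite setD1K //; congr (_ + _).
    by rewrite p_sign mulrA face_signD1s face_sign_sq mul1r.
  rewrite (eq_bigl (fun b => b \notin B)) => [|b]; last first.
    rewrite !inE; case: eqP => [->|] /=; last by rewrite andbT.
    by rewrite aB.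
  apply: eq_bigr => b bB; rewrite p_sign !mulrA /G mulrA -mulNr.
  have aB' : a \notin B :\ a by rewrite !inE eqxx.
  have bB' : b \notin B :\ a by rewrite !inE negb_and bB orbT.
  have:= face_sign_swap (neq _ _ aB bB) aB' bB'; rewrite setD1K // => e.
  congr (_ * _); rewrite -face_signD1s.
  have -> : face_sign a (b |: B) = face_sign a (b |: B :\ a).
    rewrite -(face_signU1s a (b |: B :\ a)); congr face_sign.
    by rewrite setUCA setD1K.
  by rewrite e opprK.
rewrite addrACA [X in _ + (X + _)](exchange_big_dep (mem B)) //=.
rewrite -[X in _ + X]big_split /= [X in _ + X]big1 => [|a aB]; last first.
  rewrite sumrN (eq_bigl (fun b => b \notin B)) ?subrr // => b.
  by rewrite [a \in B]aB andbT.
by rewrite addr0 [RHS](bigID (mem B)) /= addrC.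
Qed.

End Simplex.

(** * Monomials in the support of a polynomial *)

Section MonomialProjection.
Variables (k : fieldType) (n : nat).
Implicit Types (p : {mpoly k[n]}) (u v : 'X_{1..n}) (P : pred 'X_{1..n}).

Lemma mpolyX_neq0 u : 'X_[u] != 0 :> {mpoly k[n]}.
Proof.
apply/eqP=> /(congr1 (mcoeff u)); rewrite mcoeffX eqxx mcoeff0.
by apply/eqP; rewrite oner_neq0.
Qed.

Lemma mpoly_divX u p : (forall v, v \in msupp p -> (u <= v)%MM) ->
  exists c, 'X_[u] * c = p.
Proof.
move=> up; exists (\sum_(v <- msupp p) p@_v *: 'X_[v - u]).
rewrite mulr_sumr [RHS]mpolyE; apply: eq_big_seq => v /up uv.
by rewrite -scalerAr -mpolyXD addmC submK.
Qed.

Lemma mpolyX_mul_lem u c v : v \in msupp ('X_[u] * c : {mpoly k[n]}) ->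
  (u <= v)%MM.
Proof.
rewrite mcoeff_msupp [c]mpolyE mulr_sumr raddf_sum /=.
apply: contraNT => uv; rewrite big1 // => w _.
rewrite -scalerAr -mpolyXD mcoeffZ mcoeffX; case: eqP => [e|]; last by rewrite mulr0.
by move: uv; rewrite -e lem_addr.
Qed.

(** Linear over [k] but in general not over the polynomial ring, which is why the cone homotopy is
    built from additive maps. *)
Definition mproj P p : {mpoly k[n]} := \sum_(v <- msupp p | P v) p@_v *: 'X_[v].

Lemma mcoeff_mproj P p v : (mproj P p)@_v = if P v then p@_v else 0.
Proof.
rewrite {2}[p]mpolyE /mproj big_mkcond !raddf_sum /=; case: (boolP (P v)) => Pv.
  apply: eq_bigr => w _; case: ifPn => // Pw; rewrite mcoeff0 mcoeffZ mcoeffX.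
  by case: eqP Pw => [->|]; rewrite ?Pv ?mulr0.
rewrite big1 // => w _; case: ifPn => [Pw|]; last by rewrite mcoeff0.
by rewrite mcoeffZ mcoeffX; case: eqP Pw => [->|]; rewrite ?(negPf Pv) ?mulr0.
Qed.

Fact mproj_is_zmod_morphism P : zmod_morphism (mproj P).
Proof.
move=> p r; apply/mpolyP=> v; rewrite !(mcoeffB, mcoeff_mproj).
by case: ifP; rewrite ?subr0.
Qed.

HB.instance Definition _ P :=
  GRing.isZmodMorphism.Build _ _ (mproj P) (mproj_is_zmod_morphism P).

Lemma msupp_mproj P p v : v \in msupp (mproj P p) -> v \in msupp p /\ P v.
Proof.
by rewrite !mcoeff_msupp mcoeff_mproj; case: ifP => // _; rewrite eqxx.
Qed.

End MonomialProjection.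

(** * The Taylor resolution *)

Section TaylorCoordinates.
Variables (k : fieldType) (n q : nat) (m : 'I_q -> 'X_{1..n}).
Local Notation S := {mpoly k[n]}.
Local Notation T := (taylor_mod k n q).
Local Notation lcmm := (lcm_of m).
Implicit Types (A B : {set 'I_q}) (phi : {set 'I_q} -> S).

Lemma lcm_ofS A B : A \subset B -> (lcmm A <= lcmm B)%MM.
Proof.
by move=> /subsetP AB; apply/lem_lcm_ofP => i /AB; apply: lcm_of_ub.
Qed.

Lemma lcm_of1 a : lcmm [set a] = m a.
Proof.
apply: lem_anti; last by apply: lcm_of_ub; rewrite inE.
by apply/lem_lcm_ofP => i /set1P->; exact: lepm_refl.
Qed.

(** Extension by zero to subsets of every size lets [a |: B] serve as an index without a proof of
    its cardinality. *)
Definition tcoord i (t : T i) A : S :=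
  if insub A is Some w then t w else 0.

Lemma tcoord_val i (t : T i) w : tcoord t (val w) = t w.
Proof. by rewrite /tcoord valK. Qed.

Lemma tcoord0 i (t : T i) A : #|A| != i -> tcoord t A = 0.
Proof. by move=> Ai; rewrite /tcoord insubF //; apply: negPf. Qed.

Lemma tcoordP i a (s t : T i) A :
  tcoord (a *: s + t) A = a * tcoord s A + tcoord t A.
Proof.
by rewrite /tcoord; case: insubP => [w _ _|_]; rewrite ?ffunE ?mulr0 ?addr0.
Qed.

Lemma tcoord_inj i (s t : T i) : (forall A, tcoord s A = tcoord t A) -> s = t.
Proof. by move=> st; apply/ffunP=> w; rewrite -!tcoord_val. Qed.

Lemma tcoord_finfun i (F : {set 'I_q} -> S) A :
  tcoord ([ffun w => F (val w)] : T i) A = if #|A| == i then F A else 0.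
Proof.
rewrite /tcoord; case: insubP => [w Ai <-|/negPf->//].
by rewrite ffunE (valP w).
Qed.

Lemma tcoord_diff i (t : T i.+1) B : #|B| = i ->
  tcoord (taylor_diff m t) B
  = \sum_(a | a \notin B)
      face_sign S a B * ('X_[lcmm (a |: B) - lcmm B] * tcoord t (a |: B)).
Proof.
move=> Bi; have Bw : #|B| == i by apply/eqP.
rewrite -[B in LHS]/(val (Sub B Bw : wedge_index q i)) tcoord_val.
pose G A a := tcoord t A * (face_sign S a A *
  'X_[lcmm A - lcmm (A :\ a)] * (B == A :\ a)%:R).
(* With the sum over [a] outermost, only [A = a |: B] with [a] outside [B] can contribute. *)
have -> : taylor_diff m t (Sub B Bw) =
    \sum_(a : 'I_q) \sum_(A : wedge_index q i.+1 | a \in val A) G (val A) a.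
  rewrite (exchange_big_dep predT) //= /taylor_diff sum_ffunE.
  apply: eq_bigr => A _; rewrite /taylor_diff_wedge ffunE sum_ffunE.
  rewrite [_ *: _]mulr_sumr; apply: eq_bigr => a aA.
  by rewrite /G !ffunE tcoord_val SubK.
rewrite (bigID (fun a => a \in B)) /= [X in X + _]big1 ?add0r => [|a aB]; last first.
  rewrite big1 // => A aA; rewrite /G; case: eqP => [e|]; last by rewrite !mulr0.
  by move: aB; rewrite e !inE eqxx.
apply: eq_bigr => a aB.
have aBw : #|a |: B| == i.+1 by rewrite cardsU1 aB Bi.
pose w : wedge_index q i.+1 := Sub (a |: B) aBw.
rewrite (bigD1 w) /=; last by rewrite !inE eqxx.
rewrite [X in _ + X]big1 ?addr0 => [|A /andP[aA neA]]; last first.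
  rewrite /G; case: eqP => [e|]; last by rewrite !mulr0.
  by case/negP: neA; rewrite -val_eqE /= e setD1K.
by rewrite /G setU1K // eqxx mulr1 face_signU1s mulrC mulrA.
Qed.

(* Multiplying the coordinate at A by the monomial lcm A turns the Taylor
   differential into the boundary operator of a simplex. *)
Definition hcoord i (t : T i) A : S := 'X_[lcmm A] * tcoord t A.

Lemma hcoord0 i (t : T i) A : #|A| != i -> hcoord t A = 0.
Proof. by move=> Ai; rewrite /hcoord tcoord0 ?mulr0. Qed.

Lemma hcoord_inj i (s t : T i) : (forall A, hcoord s A = hcoord t A) -> s = t.
Proof.
by move=> st; apply: tcoord_inj => A; exact: mulfI (mpolyX_neq0 _ _) _ _ (st A).
Qed.

Lemma hcoord_diff i (t : T i.+1) B :
  hcoord (taylor_diff m t) B = boundary (hcoord t) B.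
Proof.
have [Bi|Bi] := eqVneq #|B| i; last first.
  rewrite hcoord0 // /boundary big1 // => a aB.
  by rewrite hcoord0 ?mulr0 // cardsU1 aB eqSS.
rewrite /hcoord tcoord_diff // mulr_sumr; apply: eq_bigr => a aB.
rewrite mulrCA; congr (_ * _); rewrite mulrA -mpolyXD addmC submK //.
exact/lcm_ofS/subsetUr.
Qed.

(** Divisibility by the lcm, tested on monomials, lets the twist by [lcmm A] be undone. *)
Lemma hcoord_onto i phi : (forall A, #|A| != i -> phi A = 0) ->
  (forall A v, v \in msupp (phi A) -> (lcmm A <= v)%MM) ->
  exists t : T i, forall A, hcoord t A = phi A.
Proof.
move=> phi0 phi_lcm.
have /fin_all_exists[c cE] A : exists c, 'X_[lcmm A] * c = phi A.
  exact: mpoly_divX (phi_lcm A).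
exists [ffun w => c (val w)] => A; rewrite /hcoord tcoord_finfun.
by case: ifPn => // /phi0->; rewrite mulr0.
Qed.

(** The apex of the cone in multidegree [v]. Fixing it for each monomial splits a polynomial into
    pieces that are each coned off from a single vertex. *)
Definition first_divisor (v : 'X_{1..n}) : option 'I_q :=
  [pick a | (m a <= v)%MM].

Definition first_proj a : {additive S -> S} :=
  mproj (fun v => first_divisor v == Some a).

Lemma sum_first_proj (p : S) b : (forall v, v \in msupp p -> (m b <= v)%MM) ->
  \sum_a first_proj a p = p.
Proof.
move=> bp; apply/mpolyP=> v; rewrite raddf_sum /=.
have [pv|pv] := eqVneq p@_v 0.
  by rewrite big1 => [|a _]; rewrite ?mcoeff_mproj pv ?if_same.
have: (m b <= v)%MM by apply: bp; rewrite mcoeff_msupp.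
case e: (first_divisor v) => [a|] bv; last first.
  by move: e; rewrite /first_divisor; case: pickP => // /(_ b); rewrite bv.
rewrite (bigD1 a) //= mcoeff_mproj e eqxx big1 ?addr0 // => a' a'a.
by rewrite mcoeff_mproj e; case: ifP a'a => // /eqP[->]; rewrite eqxx.
Qed.

(** The cone of a Taylor chain must again come from a Taylor chain. A monomial kept by
    [first_proj a] is divisible by [lcmm (A :\ a)] and, by the choice of apex, by [m a], hence by
    [lcmm A]. *)
Lemma msupp_cone_homotopy i (x : T i) A v :
  v \in msupp (cone_homotopy first_proj (hcoord x) A) -> (lcmm A <= v)%MM.
Proof.
rewrite mcoeff_msupp raddf_sum /=; apply: contraNT => Av; rewrite big1 // => a aA.
rewrite /face_sign -signr_odd mulr_sign (fun_if (mcoeff v)) mcoeffN.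
suff -> : (first_proj a (hcoord x (A :\ a)))@_v = 0 by rewrite oppr0 if_same.
apply/eqP; rewrite mcoeff_eq0; apply: contra Av => /msupp_mproj[].
move=> /mpolyX_mul_lem Av; rewrite /first_divisor.
case: pickP => // a' a'v /eqP[e]; rewrite e in a'v => {a' e}.
by rewrite -(setD1K aA) lcm_ofU lem_mlcm Av andbT; apply/lem_lcm_ofP => b /set1P->.
Qed.

Lemma taylor_diffK i (x : T i.+2) : taylor_diff m (taylor_diff m x) = 0.
Proof.
apply: hcoord_inj => A; rewrite hcoord_diff.
transitivity (boundary (boundary (hcoord x)) A).
  by apply: eq_bigr => a _; rewrite hcoord_diff.
rewrite boundaryK /hcoord /tcoord.
by case: insubP => [w _ _|_]; rewrite ?ffunE mulr0.
Qed.

Lemma taylor_exact i (x : T i.+1) :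
  taylor_diff m x = 0 <-> exists y : T i.+2, x = taylor_diff m y.
Proof.
split=> [dx|[y ->]]; last exact: taylor_diffK.
have [A Ai|y yE] := @hcoord_onto i.+2 (cone_homotopy first_proj (hcoord x)) _
  (@msupp_cone_homotopy _ x).
  rewrite /cone_homotopy big1 // => a aA; rewrite hcoord0 ?raddf0 ?mulr0 //.
  by apply: contra Ai; rewrite (cardsD1 a A) aA => /eqP->.
exists y; apply: hcoord_inj => B; rewrite hcoord_diff.
have [Bi|Bi] := eqVneq #|B| i.+1; last first.
  rewrite hcoord0 // /boundary big1 // => a aB.
  by rewrite hcoord0 ?mulr0 // cardsU1 aB eqSS.
(* In positive degree [B] is nonempty, so every monomial of [hcoord x B] is divisible by some
   generator and the projections sum to the identity. *)
have [b bB] : exists b, b \in B by apply/set0Pn; rewrite -card_gt0 Bi.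
have := boundary_homotopy first_proj (hcoord x) B.
rewrite (@sum_first_proj _ b) => [<-|v /mpolyX_mul_lem]; last first.
  by apply: lepm_trans; apply: lcm_of_ub.
rewrite [X in _ + X](_ : _ = 0) ?addr0.
  by apply: eq_bigr => a _; rewrite yE.
rewrite /cone_homotopy big1 // => a aB; rewrite -hcoord_diff dx.
by rewrite /hcoord /tcoord; case: insubP => [w _ _|_];
  rewrite ?ffunE !(mulr0, raddf0).
Qed.

End TaylorCoordinates.

(** * The quotient as a cyclic module *)

Section QuotientModuleFacts.
Variables (R : comNzRingType) (I : idealr R).
Local Open Scope quotient_scope.

Definition quot_one : quot_mod I := \pi_{ideal_quot I} 1.

Lemma quot_scale_oneE (a : R) : a *: quot_one = \pi_{ideal_quot I} a :> quot_mod I.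
Proof. by rewrite /quot_one [LHS]/(quot_scale _ _) /quot_scale rmorph1 mulr1. Qed.

Lemma quot_scale_one_eq0 (a : R) : (a *: quot_one = 0) <-> a \in I.
Proof.
rewrite quot_scale_oneE -[a in a \in I]subr0 Quotient.idealrBE.
split=> [e|/eqP->]; last by rewrite raddf0.
by apply/eqP; rewrite -[in RHS](raddf0 (\pi_{ideal_quot I})) in e.
Qed.

Lemma quot_scale_one_surj (y : quot_mod I) : exists a, a *: quot_one = y.
Proof. by exists (repr (y : {ideal_quot I})); rewrite quot_scale_oneE reprK. Qed.

End QuotientModuleFacts.

Section TaylorResolution.
Variables (k : fieldType) (n q : nat) (I : idealr {mpoly k[n]}).
Variable m : 'I_q -> 'X_{1..n}.
Hypothesis Im : generated_by I (fun i => 'X_[m i] : {mpoly k[n]}) setT.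
Local Notation T := (taylor_mod k n q).

Definition taylor_aug (t : T 0) : quot_mod I := tcoord t set0 *: quot_one I.

Fact taylor_aug_is_linear : linear taylor_aug.
Proof. by move=> a s t; rewrite /taylor_aug tcoordP scalerDl scalerA. Qed.

HB.instance Definition _ := GRing.isLinear.Build {mpoly k[n]} (T 0) (quot_mod I)
  *:%R taylor_aug taylor_aug_is_linear.

Lemma taylor_aug_surj y : exists t, taylor_aug t = y.
Proof.
have [a <-] := quot_scale_one_surj y; exists [ffun w => a].
by rewrite /taylor_aug (tcoord_finfun _ (fun=> a)) cards0 eqxx.
Qed.

Lemma tcoord_diff0 (y : T 1) :
  tcoord (taylor_diff m y) set0 = \sum_a tcoord y [set a] * 'X_[m a].
Proof.
rewrite tcoord_diff ?cards0 //; apply: eq_big => [a|a _]; first by rewrite inE.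
rewrite setU0 /face_sign (_ : [set b in set0 | _] = set0) ?cards0 ?mul1r; last first.
  by apply/setP=> b; rewrite !inE.
by rewrite mulrC lcm_of1 /lcm_of big_set0 subm0.
Qed.

Lemma taylor_exact0 x :
  taylor_aug x = 0 <-> exists y : T 1, x = taylor_diff m y.
Proof.
rewrite quot_scale_one_eq0; split=> [/Im[c xc]|[y ->]]; last first.
  apply/Im; exists (fun a => tcoord y [set a]); rewrite tcoord_diff0.
  by apply: eq_bigl => a; rewrite inE.
(* The coefficient [c a] is placed at the singleton of [a], whose element [pick] recovers. *)
pose F (A : {set 'I_q}) : {mpoly k[n]} := if [pick a in A] is Some a then c a else 0.
exists [ffun w => F (val w)].
apply: tcoord_inj => A; have [/eqP|A0] := eqVneq #|A| 0%N; last by rewrite !tcoord0.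
rewrite cards_eq0 => /eqP->; rewrite tcoord_diff0 xc.
apply: eq_big => [a|a _]; first by rewrite inE.
rewrite (tcoord_finfun _ F) cards1 eqxx /F;
case: pickP => [b|/(_ a)]; rewrite inE ?eqxx //.
by move=> /eqP->.
Qed.

Definition taylor_resolution : projective_resolution (quot_mod I) :=
  @ProjectiveResolution _ (quot_mod I) T (fun i => @taylor_diff k n q m i)
    taylor_aug (fun i => @projective_free _ _)
    taylor_aug_surj taylor_exact0 (taylor_exact m).

Lemma taylor_mod0 i (x : T i) : (q < i)%N -> x = 0.
Proof.
move=> qi; apply/ffunP=> w; have:= max_card (mem (val w)).
by rewrite (eqP (valP w)) card_ord leqNgt qi.
Qed.

Lemma taylor_length : has_projective_resolution_of_length (quot_mod I) q.
Proof. by exists taylor_resolution => i qi x; exact: taylor_mod0. Qed.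

End TaylorResolution.

(** * Projective dimension *)

Section ProjectiveDimensionBounds.
Variables (k : fieldType) (n q : nat) (I : idealr {mpoly k[n]}).
Variable m : 'I_q -> 'X_{1..n}.
Hypothesis Im : generated_by I (fun i => 'X_[m i] : {mpoly k[n]}) setT.
Local Notation T := (taylor_mod k n q).

(** A shorter resolution would split the top differential. By minimality the basis vector of the top
    module would then be a sum of multiples of the variables, yet its coordinate 1 has a nonzero
    constant term. *)
Lemma taylor_minimal_length e : taylor_minimal k m ->
  has_projective_resolution_of_length (quot_mod I) e -> (q <= e)%N.
Proof.
move=> minT res_e; rewrite leqNgt; apply/negP=> eq.
have q_gt0 : (0 < q)%N by apply: leq_ltn_trans eq.
have e_le : (e <= q.-1)%N by rewrite -ltnS prednK.
have [x|h hK] := top_differential_split (P := taylor_resolution Im) res_e e_le.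
  by apply: taylor_mod0; rewrite prednK.
have Tq : #|[set: 'I_q]| == q.-1.+1 by rewrite cardsT card_ord prednK.
have [t tE] := minT _ (wedge k n q.-1.+1 setT).
have := hK (wedge k n q.-1.+1 setT); rewrite [res_diff _ _ _]tE linear_sum /=.
pose c (s : T q.-1.+1) : {mpoly k[n]} := tcoord s setT.
move=> /(congr1 c)/(congr1 (mcoeff 0%MM)); rewrite {2}/c /wedge.
rewrite (tcoord_finfun _ (fun B => (B == setT)%:R)) Tq eqxx mcoeff1 eqxx
  (_ : c _ = \sum_(j < n) 'X_j * c (h (t j))).
  rewrite raddf_sum big1 /= => [|j _].
    by move/esym/eqP; rewrite oner_eq0.
  apply/eqP; rewrite mcoeff_eq0; apply/negP=> /mpolyX_mul_lem /mnm_lepP/(_ j).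
  by rewrite mnm1E eqxx mnm0E.
have c_lin : linear (c : _ -> {mpoly k[n]}^o) by move=> a s s'; exact: tcoordP.
pose C := GRing.isLinear.Build _ _ {mpoly k[n]}^o *:%R c c_lin.
pose cl : {linear _ -> {mpoly k[n]}^o} := HB.pack c C.
by rewrite -[c]/(cl : _ -> _) linear_sum; apply: eq_bigr => j _; rewrite !linearZ.
Qed.

(** * Cancelling a unit entry of the top differential *)

Section RedundantGenerator.
Variable i0 : 'I_q.
Hypothesis lcm_i0 : lcm_of m (setT :\ i0) = lcm_of m setT.

(** Inverse to the entry of the last differential at [setT :\ i0], a sign because [lcm_i0] makes its
    monomial 1. The map is zero unless [i.+1] equals [q], since only then is [setT] an index. *)
Definition top_retract i (t : T i) : T i.+1 :=
  [ffun w => if val w == setT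
             then face_sign _ i0 setT * tcoord t (setT :\ i0) else 0].

Fact top_retract_is_linear i : linear (@top_retract i).
Proof.
move=> a s t; apply/ffunP=> w; rewrite !ffunE tcoordP.
case: ifP => _; last by rewrite scaler0 addr0.
by rewrite mulrDr mulrCA.
Qed.

HB.instance Definition _ i := GRing.isLinear.Build {mpoly k[n]} (T i) (T i.+1)
  *:%R (@top_retract i) (@top_retract_is_linear i).

Lemma tcoord_top_retract i (t : T i) A : A != setT -> tcoord (top_retract t) A = 0.
Proof.
move=> AT; pose F (A : {set 'I_q}) : {mpoly k[n]} := if A == setT
             then face_sign _ i0 setT * tcoord t (setT :\ i0) else 0.
by rewrite /top_retract (tcoord_finfun _ F) /F (negPf AT) if_same.
Qed.

Let setT_neq : setT :\ i0 != setT.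
Proof. by apply/eqP=> /setP/(_ i0); rewrite !inE eqxx. Qed.

Lemma top_retract_sq i (t : T i) : top_retract (top_retract t) = 0.
Proof.
apply/ffunP=> w; rewrite !ffunE; case: ifP => // _.
by rewrite tcoord_top_retract ?mulr0 ?setT_neq.
Qed.

(** Only [i0] lies outside [setT :\ i0], so a single term of the differential is read, and its sign
    cancels that of [top_retract]. *)
Lemma tcoord_top_retract_diff i (t : T i.+1) A :
  tcoord (top_retract (taylor_diff m t)) A
  = if A == setT then tcoord t A else 0.
Proof.
case: ifPn => [/eqP->|/tcoord_top_retract->//].
pose F (A : {set 'I_q}) : {mpoly k[n]} := if A == setT
   then face_sign _ i0 setT * tcoord (taylor_diff m t) (setT :\ i0) else 0.
rewrite /top_retract (tcoord_finfun _ F) /F eqxx.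
case: ifPn => [/eqP Ti|Ti]; last by rewrite tcoord0.
rewrite tcoord_diff; last first.
  by apply/eqP; rewrite -eqSS -Ti [in X in _ == X](cardsD1 i0) inE.
rewrite (big_pred1 i0) => [|a]; last by rewrite !inE andbT negbK.
rewrite setD1K ?inE // lcm_i0 [in 'X_[_]](_ : (_ - _)%MM = 0%MM) ?mpolyX0;
  last first.
  by apply/mnmP=> j; rewrite mnmBE subnn mnm0E.
by rewrite mul1r mulrA face_signD1s
  face_sign_sq mul1r.
Qed.

Lemma redundant_generator_length :
  has_projective_resolution_of_length (quot_mod I) q.-1.
Proof.
apply: (@resolution_shorten _ _ (taylor_resolution Im)
          (fun i => @top_retract i : {linear T i -> T i.+1})).
- by move=> i x; exact: top_retract_sq.
- move=> i x; apply: tcoord_inj => A; rewrite tcoord_top_retract_diff.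
  by case: ifPn => // /tcoord_top_retract->.
(* In degree [i.+1 >= q] the target of [top_retract] is zero and the full set is the only possible
   index, so [top_retract] after the differential is the identity. *)
move=> i qi x; have q_le : (q <= i.+1)%N.
  by apply: leq_trans (leqSpred q) _; rewrite ltnS.
change (taylor_diff m (top_retract x) + top_retract (taylor_diff m x) = x).
rewrite (taylor_mod0 (top_retract _)) // linear0 add0r.
apply: tcoord_inj => A; rewrite tcoord_top_retract_diff.
case: ifPn => // AT; rewrite tcoord0 //; apply/negP=> /eqP Ai.
by case/negP: AT; rewrite eqEcard subsetT cardsT card_ord Ai.
Qed.

End RedundantGenerator.
End ProjectiveDimensionBounds.

(** * Minimal monomial generators *)

Section MinimalGenerators.
Variables (k : fieldType) (n q : nat) (I : idealr {mpoly k[n]}).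
Variable m : 'I_q -> 'X_{1..n}.
Hypothesis hm : minimal_monomial_generators I m.
Local Notation S := {mpoly k[n]}.

Lemma monomial_generator_in i : ('X_[m i] : S) \in I.
Proof.
apply/(proj1 hm); exists (fun l => (l == i)%:R).
rewrite (bigD1 i) ?inE //= eqxx mul1r big1 ?addr0 // => l /andP[_ /negPf->].
by rewrite mul0r.
Qed.

(** A generator equal to 1 would make the ideal improper, which [idealr] excludes. *)
Lemma monomial_generator_neq0 i : m i <> 0%MM.
Proof.
by move=> mi0; have := monomial_generator_in i; rewrite mi0 mpolyX0 idealr1.
Qed.

Lemma monomial_generators_antichain i l : (m i <= m l)%MM -> i = l.
Proof.
move=> mil; apply/eqP/negPn/negP=> nil.
apply: (proj2 hm (setT :\ l)).
  by rewrite properT; apply/eqP=> /setP/(_ l); rewrite !inE eqxx.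
move=> g; split=> [/(proj1 hm)[c ->]|[c ->]].
  (* The multiple of [m l] is absorbed into the coefficient of [m i], so the generators other than
     [m l] would suffice, against irredundancy. *)
  exists (fun j => if j == i then c i + c l * 'X_[m l - m i] else c j).
  rewrite (bigD1 l) ?inE //= (bigD1 i) ?inE //= [RHS](bigD1 i) ?inE ?nil //=.
  rewrite eqxx mulrDl -mulrA -mpolyXD submK // addrCA addrA; congr (_ + _).
  apply: eq_big => [j|j /andP[_ /negPf->] //].
  by rewrite !inE andbT.
apply/(proj1 hm); exists (fun j => if j == l then 0 else c j).
rewrite [RHS](bigD1 l) ?inE //= eqxx mul0r add0r.
apply: eq_big => [j|j]; first by rewrite !inE andbT.
by rewrite !inE andbT => /negPf->.
Qed.

Lemma mcoeff_mul_generator (p : S) i l :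
  (p * 'X_[m i])@_(m l) = if i == l then p@_0%MM else 0.
Proof.
case: eqVneq => [->|il]; first by have := mcoeffMX p (m l) 0%MM; rewrite addm0.
apply/eqP; rewrite mcoeff_eq0 mulrC; apply/negP=> /mpolyX_mul_lem.
by move=> /monomial_generators_antichain/eqP; rewrite (negPf il).
Qed.

(* The classes of the monomials m i form a basis of I / (x_1, ..., x_n) I. *)
Lemma minimal_generators_number : min_number_of_generators I q.
Proof.
split=> [|e f If]; first by exists (fun i => 'X_[m i]); exact: proj1 hm.
have fI j : f j \in I.
  apply/If; exists (fun l => (l == j)%:R).
  rewrite (bigD1 j) ?inE //= eqxx mul1r big1 ?addr0 // => l /andP[_ /negPf->].
  by rewrite mul0r.
have /fin_all_exists[b bE] i := proj1 (If _) (monomial_generator_in i).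
have /fin_all_exists[a aE] j := proj1 (proj1 hm _) (fI j).
(* Each family is expressed through the other; passing to constant terms is reduction modulo the
   ideal of the variables. *)
pose B : 'M[k]_(q, e) := \matrix_(i, j) (b i j)@_0%MM.
pose A : 'M[k]_(e, q) := \matrix_(j, l) (a j l)@_0%MM.
have BA : B *m A = 1%:M.
  apply/matrixP=> i l; rewrite !mxE.
  (* By the antichain property, the coefficient at the monomial [m l] sees only the constant term of
     the multiplier of the generator [m l]. *)
  have -> : (i == l)%:R = ('X_[m i] : S)@_(m l).
    rewrite mcoeffX (_ : (m i == m l) = (i == l)) //.
    apply/eqP/eqP=> [e_il|->//].
    by apply: monomial_generators_antichain; rewrite e_il lepm_refl.
  rewrite bE raddf_sum /=; apply: eq_big => [j|j _]; first by rewrite inE.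
  rewrite !mxE aE mulr_sumr raddf_sum /= (bigD1 l) ?inE //= big1 ?addr0.
    by rewrite mulrA mcoeff_mul_generator eqxx rmorphM.
  by move=> l' /andP[_ /negPf ll']; rewrite mulrA mcoeff_mul_generator ll'.
by rewrite -(mxrank1 k q) -BA (leq_trans (mxrankM_maxl _ _)) ?rank_leq_col.
Qed.

End MinimalGenerators.

(** * Generators with a private prime power *)

Section LcmCombinatorics.
Variables (n q : nat) (m : 'I_q -> 'X_{1..n}).
Implicit Types (A B : {set 'I_q}) (i l : 'I_q) (j : 'I_n).

Definition irredundant : Prop :=
  forall i, ~~ (m i <= lcm_of m (setT :\ i))%MM.

Lemma lcm_ofE A j : lcm_of m A j = \max_(i in A) m i j.
Proof.
apply: (big_morph (fun u : 'X_{1..n} => u j)); last exact: mnm0E.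
by move=> u v; rewrite mnmE.
Qed.

Lemma mnm_pow_lem j e (u : 'X_{1..n}) : (U_(j) *+ e <= u)%MM = (e <= u j)%N.
Proof.
apply/mnm_lepP/idP => [/(_ j)|ej l]; first by rewrite mulmnE mnm1E eqxx mul1n.
by rewrite mulmnE mnm1E; case: eqP => [<-|]; rewrite ?mul1n.
Qed.

(** Failure of divisibility shows in the exponent of one variable [j], and [e] can be taken to be
    the exponent of that variable in [m i]. *)
Lemma irredundantP :
  irredundant <->
  forall i, exists j e, [/\ (0 < e)%N, (U_(j) *+ e <= m i)%MM
     & forall l, l != i -> ~~ (U_(j) *+ e <= m l)%MM].
Proof.
split=> [irr i|priv i].
  have [j ij] : exists j, (lcm_of m (setT :\ i) j < m i j)%N.
    apply/existsP; rewrite -[[exists _, _]]negbK negb_exists; apply/negP.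
    by move=> /forallP le_mi; case/negP: (irr i); apply/mnm_lepP => j;
      rewrite leqNgt.
  exists j, (m i j); split; first exact: leq_ltn_trans ij.
    by rewrite mnm_pow_lem.
  move=> l li; rewrite mnm_pow_lem -ltnNge; apply: leq_ltn_trans ij.
  by apply/mnm_lepP/lcm_of_ub; rewrite !inE li.
have [j [e [e_gt0 ei el]]] := priv i.
apply/negP=> /mnm_lepP/(_ j); rewrite leqNgt => /negP[].
apply: leq_trans (_ : e <= _)%N; last by rewrite -mnm_pow_lem.
(* Positivity of [e] turns the strict bound into a bound by [e.-1], which also covers an empty
   maximum, equal to 0. *)
rewrite lcm_ofE -(prednK e_gt0) ltnS; apply/bigmax_leqP => l.
rewrite !inE andbT => /el; rewrite mnm_pow_lem -ltnNge.
by rewrite -{1}(prednK e_gt0) ltnS.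
Qed.

(** If [i] is outside [A], then [A] lies in [setT :\ i], whose lcm [m i] does not divide. A subset
    is thus recovered from its lcm. *)
Lemma irredundant_mem i A : irredundant ->
  (m i <= lcm_of m A)%MM = (i \in A).
Proof.
move=> irr; apply/idP/idP => [iA|]; last exact: lcm_of_ub.
apply: contraR (irr i) => niA; apply: lepm_trans iA _; apply: lcm_ofS.
by apply/subsetP=> l lA; rewrite !inE andbT; apply: contra niA => /eqP<-.
Qed.

Local Open Scope order_scope.

Lemma lcm_elt_meet A B : irredundant ->
  lcm_elt m A `&` lcm_elt m B = lcm_elt m (A :&: B).
Proof.
move=> irr; apply: val_inj; congr (lcm_of m _); apply/setP=> i.
by rewrite !inE /= !irredundant_mem.
Qed.

Lemma lcm_elt_join A B : lcm_elt m A `|` lcm_elt m B = lcm_elt m (A :|: B).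
Proof. by apply: val_inj; rewrite /= lcm_ofU. Qed.

Lemma lcm_elt_inj : irredundant -> injective (lcm_elt m).
Proof.
move=> irr A B /(congr1 val)/= AB.
by apply/setP=> i; rewrite -!irredundant_mem // AB.
Qed.

Lemma irredundant_boolean : irredundant -> boolean_lattice (lcm_lattice m).
Proof.
move=> irr; split=> [x y z|x].
  have [[A ->] [B ->] [C ->]] := And3 (lcm_eltP x) (lcm_eltP y) (lcm_eltP z).
  by rewrite lcm_elt_join !lcm_elt_meet // lcm_elt_join setIUr.
have [A ->] := lcm_eltP x; exists (lcm_elt m (~: A)); split.
  by rewrite /complements lcm_elt_meet // lcm_elt_join setICr setUCr.
move=> y; have [B ->] := lcm_eltP y => -[].
rewrite lcm_elt_meet // lcm_elt_join.
move=> /(lcm_elt_inj irr)/setP AB0 /(lcm_elt_inj irr)/setP ABT; congr lcm_elt.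
apply/setP=> i; have := ABT i; have := AB0 i; rewrite !inE.
by case: (i \in A) => //= ->.
Qed.

Lemma boolean_irredundant :
  (forall i, m i <> 0%MM) -> (forall i l, (m i <= m l)%MM -> i = l) ->
  boolean_lattice (lcm_lattice m) -> irredundant.
Proof.
move=> m_neq0 anti [distr _] i; apply/negP=> red.
(* A generator dividing both [m i] and [m l] would equal both, so no generator lies below this
   meet. *)
have atom_meet l : l != i -> lcm_elt m [set i] `&` lcm_elt m [set l] = \bot.
  move=> li; apply: val_inj; congr (lcm_of m _); apply/setP=> g.
  rewrite !inE /= !lcm_of1; apply/negP=> /andP[/anti gi /anti gl].
  by rewrite -gi -gl eqxx in li.
have meet0 A : i \notin A -> lcm_elt m [set i] `&` lcm_elt m A = \bot.
  (* Induction on the size of [A], splitting off one generator by distributivity. *)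
  have [N] := ubnP #|A|; elim: N A => // N IH A AN iA.
  have [->|[l lA]] := set_0Vmem A; first exact: meetx0.
  rewrite -(setD1K lA) -lcm_elt_join distr atom_meet; last first.
    by apply: contra iA => /eqP<-.
  rewrite IH ?joinx0 //; last by rewrite inE negb_and iA orbT.
  by move: AN; rewrite (cardsD1 l) lA.
have /meet0 : i \notin setT :\ i by rewrite !inE eqxx.
rewrite (_ : _ `&` _ = lcm_elt m [set i]); last first.
  by apply/meet_idPl; rewrite -[_ <= _]/(_ <= _)%MM /= lcm_of1.
by move=> /(congr1 val)/=; rewrite lcm_of1 /lcm_of big_set0; exact: m_neq0.
Qed.

End LcmCombinatorics.

(** * Multiples of the ideal of the variables, and minimality of the Taylor complex *)

Section MaximalIdealMultiples.
Variables (k : fieldType) (n : nat) (M : lmodType {mpoly k[n]}).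
Implicit Types (x y : M) (u : 'X_{1..n}).

Lemma in_max_ideal_mul_sum (J : finType) (P : pred J) (F : J -> M) :
  (forall j, P j -> in_max_ideal_mul (F j)) ->
  in_max_ideal_mul (\sum_(j | P j) F j).
Proof.
move=> FP; apply: (big_ind (@in_max_ideal_mul k n M)) => //.
  by exists (fun=> 0); rewrite big1 // => j _; rewrite scaler0.
move=> _ _ [s ->] [t ->]; exists (fun j => s j + t j).
by rewrite -big_split; apply: eq_bigr => j _; rewrite scalerDr.
Qed.

Lemma in_max_ideal_mulZ (a : {mpoly k[n]}) x :
  in_max_ideal_mul x -> in_max_ideal_mul (a *: x).
Proof.
move=> [t ->]; exists (fun j => a *: t j); rewrite scaler_sumr.
by apply: eq_bigr => j _; rewrite !scalerA mulrC.
Qed.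

Lemma in_max_ideal_mulX u x : u != 0%MM -> in_max_ideal_mul ('X_[u] *: x).
Proof.
move=> u0; have [j uj] : exists j, (0 < u j)%N.
  apply/existsP; apply: contraR u0; rewrite negb_exists => /forallP u0.
  by apply/eqP/mnmP=> j; rewrite mnm0E; apply/eqP; rewrite -leqn0 leqNgt.
exists (fun l => if l == j then 'X_[u - U_(j)] *: x else 0).
rewrite (bigD1 j) //= eqxx big1 ?addr0 => [|l /negPf->]; last exact: scaler0.
rewrite scalerA -mpolyXD addmC submK //.
by apply/mnm_lepP=> l; rewrite mnm1E; case: eqP => // <-.
Qed.

End MaximalIdealMultiples.

(** A constant entry would mean that deleting [a] from [A] keeps the lcm, so that [m a] would divide
    the lcm of the other generators in [A]. *)
Lemma irredundant_taylor_minimal (k : fieldType) n q (m : 'I_q -> 'X_{1..n}) :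
  irredundant m -> taylor_minimal k m.
Proof.
move=> irr i t; apply: in_max_ideal_mul_sum => A _; apply: in_max_ideal_mulZ.
apply: in_max_ideal_mul_sum => a aA; rewrite -scalerA.
apply/in_max_ideal_mulZ/in_max_ideal_mulX; apply/eqP=> lcm_eq.
have: (m a <= lcm_of m (val A :\ a))%MM.
  apply: lepm_trans (lcm_of_ub m aA) _; apply/mnm_lepP=> j.
  by rewrite -subn_eq0 -mnmBE lcm_eq mnm0E.
by rewrite irredundant_mem // !inE eqxx.
Qed.

Theorem theorem3p3 (k : fieldType) (n q : nat) (I : idealr {mpoly k[n]})
    (m : 'I_q -> 'X_{1..n}) (hm : minimal_monomial_generators I m) :
  [<-> boolean_lattice (lcm_lattice m);
       forall i : 'I_q, exists (j : 'I_n) (e : nat),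
         [/\ (0 < e)%N, (U_(j) *+ e <= m i)%MM
           & forall l : 'I_q, l != i -> ~~ (U_(j) *+ e <= m l)%MM];
       taylor_minimal k m;
       exists2 d : nat, projective_dimension (quot_mod I) d
                      & min_number_of_generators I d].
Proof.
have Im := proj1 hm; have q_min := minimal_generators_number hm.
tfae.
- move=> boolean; apply/irredundantP; apply: boolean_irredundant boolean.
    exact: monomial_generator_neq0 hm.
  exact: monomial_generators_antichain hm.
- by move=> /irredundantP; exact: irredundant_taylor_minimal.
- move=> minT; exists q => //; split; first exact: taylor_length Im.
  by move=> e; exact: taylor_minimal_length.
(* If [m i] divided the lcm of the others, a resolution of length [q.-1] would exist, so
   [d <= q.-1]; but [d] elements generate the ideal, so [q <= d]. *)
move=> [d [_ d_le] d_min]; apply: irredundant_boolean => i; apply/negP=> red.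
have q_le_d : (q <= d)%N.
  by have [[f If] _] := d_min; apply: (proj2 q_min) If.
have: (d <= q.-1)%N.
  apply: d_le; apply: (redundant_generator_length Im (i0 := i)).
  apply: lem_anti; first exact/lcm_ofS/subsetT.
  apply/lem_lcm_ofP=> l _; have [->//|li] := eqVneq l i.
  by apply: lcm_of_ub; rewrite !inE li.
by rewrite leqNgt (leq_trans _ q_le_d) // ltn_predL (leq_ltn_trans _ (ltn_ord i)).
Qed.
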